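(* The existence of DC3 pairs is not preserved by topological conjugacy. That is, there exist topologically conjugate topological dynamical systems $(X,f)$ and $(Y,g)$ on compact metric spaces such that $(X,f)$ has a DC3 pair while $(Y,g)$ has no DC3 pair.
   Context: A topological dynamical system $(X,f)$ consists of a non-empty compact metric space $(X,d)$ and a continuous map $f:X\to X$. Systems $(X,f)$ and $(Y,g)$ are topologically conjugate if there is a continuous bijection $\pi:X\to Y$ with $\pi\circ f=g\circ\pi$. For $(x_1,x_2)\in X^2$ and $\delta>0$ put $$\Phi_{(x_1,x_2)}(\delta)=\liminf_{m\to\infty}\frac1m\#\{0\le k\le m: d(f^k(x_1),f^k(x_2))<\delta\},$$ $$\Phi^*_{(x_1,x_2)}(\delta)=\limsup_{m\to\infty}\frac1m\#\{0\le k\le m: d(f^k(x_1),f^k(x_2))<\delta\}.$$ The pair is a DC3 pair (distributionally scrambled of type 3) if there are $0\le a<b\le \operatorname{diam}X$ such that $\Phi_{(x_1,x_2)}(\delta)<\Phi^*_{(x_1,x_2)}(\delta)$ for every $\delta\in(a,b)$. *)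

(* Defs.v *)
From HB Require Import structures.
From mathcomp Require Import all_boot all_order all_algebra.
From mathcomp Require Import boolp classical_sets reals.
From mathcomp Require Import topology normedtype sequences.

Set Implicit Arguments.
Unset Strict Implicit.
Unset Printing Implicit Defensive.

Import Order.TTheory GRing.Theory Num.Theory.
Import numFieldTopology.Exports numFieldNormedType.Exports.

Local Open Scope classical_set_scope.
Local Open Scope ring_scope.

(* A [metricType] may be empty, so non-emptiness is required separately. *)
Definition is_tds (R : realType) (X : metricType R) (f : X -> X) : Prop :=
  [/\ [set: X] !=set0, compact [set: X] & continuous f].

Definition conjugate (R : realType) (X Y : metricType R)
    (f : X -> X) (g : Y -> Y) : Prop :=
  exists pi : X -> Y, [/\ continuous pi, bijective pi & pi \o f =1 g \o pi].

Definition diam (R : realType) (X : metricType R) : R :=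
  sup [set r | exists x y : X, r = mdist x y].

(* The times 0 <= k <= m are counted (there are m + 1 of them) and the count is
   divided by m. The term at m = 0 is 0 by the convention on division, which
   affects neither the lower nor the upper limit. *)
Definition closeness_freq (R : realType) (X : metricType R) (f : X -> X)
    (x1 x2 : X) (delta : R) (m : nat) : R :=
  #|[pred k : 'I_m.+1 | mdist (iter k f x1) (iter k f x2) < delta]|%:R / m%:R.

(* [limn_inf] and [limn_sup] are real-valued and meaningful on bounded
   sequences; all values of [closeness_freq] lie in [0, 2]. *)
Definition Phi_lower (R : realType) (X : metricType R) (f : X -> X)
    (x1 x2 : X) (delta : R) : R :=
  limn_inf (closeness_freq f x1 x2 delta).

Definition Phi_upper (R : realType) (X : metricType R) (f : X -> X)
    (x1 x2 : X) (delta : R) : R :=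
  limn_sup (closeness_freq f x1 x2 delta).

Definition DC3_pair (R : realType) (X : metricType R) (f : X -> X)
    (x1 x2 : X) : Prop :=
  exists a b : R, [/\ 0 <= a, a < b, b <= diam X &
    forall delta : R, a < delta < b ->
      Phi_lower f x1 x2 delta < Phi_upper f x1 x2 delta].

Definition has_DC3_pair (R : realType) (X : metricType R) (f : X -> X) : Prop :=
  exists x1 x2 : X, DC3_pair f x1 x2.

(* Main.v *)
(* Each of the two components of the space is a segment [0, 1] of fixed points
   together with one orbit that moves by less and less at each step and
   accumulates on the whole segment; both orbits are asymptotically
   equidistributed in [0, 1]. Hence within a component all closeness frequencies
   converge: two fixed points stay at a constant distance, two points of the
   orbit become asymptotic, and the distance from the orbit to a fixed point has
   a limiting distribution. Only pairs with one point in each component are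
   left. The positions of the two orbits in [0, 1] alternately coincide and
   differ, during periods of exponentially growing length, so that the
   distribution of the distance between these positions does not converge. If
   the components are close to each other, the metric sees this and there is a
   DC3 pair; if they are at distance 1, all cross distances equal 1. *)
Require Import Defs.
From HB Require Import structures.
From mathcomp Require Import all_boot all_order all_algebra.
From mathcomp Require Import boolp classical_sets reals.
From mathcomp Require Import topology normedtype sequences.
From mathcomp Require Import zify lra.

Set Implicit Arguments.
Unset Strict Implicit.
Unset Printing Implicit Defensive.

Import Order.TTheory GRing.Theory Num.Theory.
Import numFieldTopology.Exports numFieldNormedType.Exports.

Local Open Scope classical_set_scope.
Local Open Scope ring_scope.

(** * Equidistribution of triangular arrays *)

Section Equidistribution.
Context {R : realType}.
Implicit Types (w : nat -> nat -> R) (x y l r : R) (b : bool).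

(** The distribution function of the uniform measure on [0, 1]. *)
Definition clip x : R := Num.max 0 (Num.min x 1).

Lemma clip_le0 x : x <= 0 -> clip x = 0.
Proof. by move=> x0; rewrite /clip (max_idPl _)// ge_min x0. Qed.

Lemma clip_ge1 x : 1 <= x -> clip x = 1.
Proof. by move=> x1; rewrite /clip (min_idPr x1) (max_idPr ler01). Qed.

Lemma clip_id x : 0 <= x <= 1 -> clip x = x.
Proof.
by move=> /andP[x0 x1]; rewrite /clip (min_idPl x1) (max_idPr x0).
Qed.

Lemma clip_itv x : 0 <= clip x <= 1.
Proof. by rewrite /clip le_max ge_max ge_min lexx ler01 lexx orbT. Qed.

Lemma le_clip x y : x <= y -> clip x <= clip y.
Proof.
move=> xy; rewrite /clip ge_max le_max lexx /= le_max le_min !ge_min xy lexx.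
by rewrite !orbT.
Qed.

Definition count_below w b x n : R :=
  \sum_(j < n.+1) (w n j < x ?<= if b)%:R.

(** Bounded discrepancy, uniformly in the row, which is stronger than convergence of proportions.
    Both kinds of inequality are covered because cutting an interval at its left end flips the
    strictness. *)
Definition equidistributed w := exists C : R, forall b x n,
  `|count_below w b x n - clip x * n.+1%:R| <= C.

(** Every index counts until [n] reaches [x]; from then on both the count and [Num.min x n%:R] stay
    fixed. *)
Lemma count_ord_below b x n :
  `|\sum_(j < n) (j%:R < x ?<= if b)%:R - Num.max 0 (Num.min x n%:R)| <= 1.
Proof.
elim: n => [|n IHn].
  by rewrite big_ord0 mulr0n (max_idPl _) ?subr0 ?normr0// ge_min lexx orbT.
rewrite big_ord_recr /=; case: (boolP (n%:R < x ?<= if b)) => nx.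
  have xn := lteifW nx.
  rewrite (eq_bigr (fun=> 1)) => [|j _]; last first.
    case: b nx {IHn xn} => /= nx.
      by rewrite (le_trans _ nx)// ler_nat ltnW.
    by rewrite (le_lt_trans _ nx)// ler_nat ltnW.
  rewrite sumr_const card_ord -natr1.
  have : n%:R <= Num.max 0 (Num.min x (n%:R + 1)) <= n%:R + 1.
    by rewrite le_max le_min ge_max ge_min xn lexx lerDl ler01 addr_ge0 ?orbT.
  by rewrite ler_norml /=; lra.
have xn : x <= n%:R by move: nx; rewrite -lteifNE => /lteifW.
rewrite addr0 (min_idPl _); last by rewrite (le_trans xn)// ler_nat.
by rewrite (min_idPl xn) in IHn.
Qed.

Lemma equidistributed_uniform : equidistributed (fun n j => j%:R / n.+1%:R).
Proof.
exists 1 => b x n; rewrite /count_below.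
under eq_bigr do rewrite lteif_pdivrMr ?ltr0n//.
have -> : clip x * n.+1%:R = Num.max 0 (Num.min (x * n.+1%:R) n.+1%:R).
  have n0 : 0 <= n.+1%:R :> R by [].
  by rewrite /clip maxr_pMl// minr_pMl// mul0r mul1r.
exact: count_ord_below.
Qed.

Lemma count_itv w b l r n : l < r ?<= if b ->
  \sum_(j < n.+1) ((l < w n j ?<= if b) && (w n j < r ?<= if b))%:R =
  count_below w b r n - count_below w (~~ b) l n.
Proof.
move=> lr; rewrite /count_below -sumrB; apply: eq_bigr => j _.
have -> : (w n j < l ?<= if ~~ b) = ~~ (l < w n j ?<= if b) by rewrite lteifNE.
case: (boolP (l < _ ?<= if b)) => /= lw; first by rewrite subr0.
suff -> : w n j < r ?<= if b by rewrite subrr.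
move: lw; rewrite -lteifNE => lw.
by have := lteif_trans lw lr; rewrite andNb; exact: (@lteif_imply _ _ false).
Qed.

Lemma count_itv_near w : equidistributed w -> exists C : R, forall b l r n,
  l < r ?<= if b ->
  `|\sum_(j < n.+1) ((l < w n j ?<= if b) && (w n j < r ?<= if b))%:R
    - (clip r - clip l) * n.+1%:R| <= C.
Proof.
move=> [C wC]; exists (C + C) => b l r n lr; rewrite count_itv//.
have := wC b r n; have := wC (~~ b) l n; rewrite !ler_norml.
move: (count_below _ _ _ _) (count_below _ _ _ _) => c1 c2; lra.
Qed.

(* The tent map preserves Lebesgue measure. *)
Lemma equidistributed_tent w :
  equidistributed w -> equidistributed (fun n j => `|2 * w n j - 1|).
Proof.
move=> wE; have [C wC] := count_itv_near wE.
have C0 : 0 <= C by apply: le_trans (wC true 0 0 0%N _) => //=.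
exists C => b x n; rewrite /count_below.
have [x0|x0] := boolP (0 < x ?<= if b); last first.
  rewrite big1 => [|j _].
    rewrite clip_le0 ?mul0r ?subrr ?normr0//.
    by move: x0; rewrite -lteifNE => /lteifW.
  by rewrite lteif_nnormr// lteifNE.
(* The values below [x] have as preimage under the tent map the interval of length [x] centred at
   1/2. *)
pose l := (1 - x) / 2; pose r := (1 + x) / 2.
have lr : l < r ?<= if b by case: b x0 => /=; rewrite /l /r; lra.
have -> : clip x = clip r - clip l.
  have x_ge0 := lteifW x0; rewrite /l /r; have [x1|/ltW x1] := leP x 1.
    by rewrite !clip_id; lra.
  by rewrite [clip x]clip_ge1// clip_ge1 ?clip_le0; lra.
rewrite (eq_bigr (fun j : 'I_n.+1 =>
    ((l < w n j ?<= if b) && (w n j < r ?<= if b))%:R)); first exact: wC.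
move=> j _; congr (_%:R); rewrite lteif_distl /l /r.
by case: b {x0 lr} => /=; congr andb; apply/idP/idP; lra.
Qed.

End Equidistribution.

(** * Frequencies along blocks of growing length *)

Section Blocks.
Context {R : realType}.
Implicit Types (F : nat -> nat -> R) (N m : nat).

(* [addr k] is the pair (n, j) such that the time k is the j-th one (from 0) of
   the block number n, which has length n + 1. *)
Definition next_addr (p : nat * nat) : nat * nat :=
  if (p.2 < p.1)%N then (p.1, p.2.+1) else (p.1.+1, 0%N).

Definition addr k : nat * nat := iter k next_addr (0%N, 0%N).

Lemma addr_bound k : ((addr k).2 <= (addr k).1)%N.
Proof. by elim: k => // k; rewrite /addr iterS /next_addr; case: ifP. Qed.

(** The blocks before block n have total length n(n+1)/2; doubling avoids the division. *)
Lemma addrE k : (k.*2 = (addr k).1 * (addr k).1.+1 + (addr k).2.*2)%N.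
Proof.
elim: k => // k; have := addr_bound k; rewrite /addr iterS /next_addr.
by case: (iter _ _ _) => n j /=; case: ltnP => /=; nia.
Qed.

Lemma addr_block N m : (m.*2 = N * N.+1)%N -> addr m = (N, 0%N).
Proof.
move=> mN; have := addrE m; have := addr_bound m; rewrite mN.
case: (addr m) => n j /= jn E.
have nN : n = N by nia.
by rewrite nN in E *; congr pair; nia.
Qed.

Lemma leq_addr1 N k : (N ^ 2 <= k)%N -> (N <= (addr k).1)%N.
Proof. by have := addr_bound k; have := addrE k; nia. Qed.

Lemma sum_blocks F m :
  \sum_(k < m) F (addr k).1 (addr k).2 =
  \sum_(n < (addr m).1) \sum_(j < n.+1) F n j
    + \sum_(j < (addr m).2) F (addr m).1 j.
Proof.
elim: m => [|m IHm]; first by rewrite !big_ord0 addr0.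
rewrite big_ord_recr {}IHm; have := addr_bound m.
rewrite [addr m.+1]/addr iterS -/(addr m) /next_addr.
case: (addr m) => n j /= jn; case: ltnP => nj /=.
  by rewrite big_ord_recr -addrA.
have -> : j = n by apply/eqP; rewrite eqn_leq jn.
by rewrite big_ord0 addr0 [in RHS]big_ord_recr [in RHS]big_ord_recr /= addrA.
Qed.

Lemma sum_nat_succ N : \sum_(n < N) n.+1%:R = (N * N.+1)%:R / 2 :> R.
Proof.
elim: N => [|N IH]; first by rewrite big_ord0 mul0n mul0r.
rewrite big_ord_recr {}IH /= !natrM -[N.+2%:R]natr1 -natr1; lra.
Qed.

(** Each complete block contributes at most [C], and the unfinished one has at most [(addr m).1]
    terms of modulus at most 1. *)
Lemma discrepancy_le F (C : R) m :
  (forall n j, `|F n j| <= 1) -> (forall n, `|\sum_(j < n.+1) F n j| <= C) ->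
  `|\sum_(k < m) F (addr k).1 (addr k).2| <= (C + 1) * (addr m).1%:R.
Proof.
move=> F1 FC; rewrite sum_blocks mulrDl mul1r.
apply: le_trans (ler_normD _ _) _; apply: lerD.
  apply: le_trans (ler_norm_sum _ _ _) _.
  apply: (@le_trans _ _ (\sum_(n < (addr m).1) C)); first exact: ler_sum.
  by rewrite sumr_const card_ord mulr_natr.
apply: le_trans (ler_norm_sum _ _ _) _.
apply: (@le_trans _ _ (\sum_(j < (addr m).2) 1)); first exact: ler_sum.
by rewrite sumr_const card_ord ler_nat addr_bound.
Qed.

Definition freq (P : nat -> bool) m : R := (\sum_(k < m.+1) (P k)%:R) / m%:R.

(** The error in the count is of the order of the number of blocks, hence of the square root of [m],
    and vanishes after division by [m]. *)
Lemma cvg_freq (P : nat -> nat -> bool) (mu C : R) :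
  0 <= mu <= 1 ->
  (forall n, `|\sum_(j < n.+1) (P n j)%:R - mu * n.+1%:R| <= C) ->
  freq (fun k => P (addr k).1 (addr k).2) @ \oo --> mu.
Proof.
move=> mu01 PC; rewrite /freq.
have C0 : 0 <= C := le_trans (normr_ge0 _) (PC 0%N).
pose F n j : R := (P n j)%:R - mu.
have FC n : `|\sum_(j < n.+1) F n j| <= C.
  by rewrite sumrB sumr_const card_ord -mulr_natr; exact: PC.
have F1 n j : `|F n j| <= 1.
  by rewrite /F ler_norml; case: (P n j) => /=; lra.
apply/cvgrPdist_le => /= e e0.
(* With N the current block number, the error is at most (C + 1) N + 1, the 1 coming from counting
   [m.+1] times but dividing by [m]. So K (N + 1) <= m suffices. *)
pose K := (C + 2) / e.
have K0 : 0 < K by rewrite divr_gt0//; lra.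
(* From N^2 <= 2 m + 2 and 2 K N <= N^2 / 2 + 2 K^2, this lower bound on m gives K (N + 1) <= m. *)
have [M KM] : exists M : nat, 2 * K ^+ 2 + 2 * K + 1 <= M%:R.
  by exists (Num.bound (2 * K ^+ 2 + 2 * K + 1)); apply/ltW/archi_boundP; nra.
exists M.+1 => // m /= Mm.
have m0 : 0 < m%:R :> R by rewrite ltr0n; lia.
have {KM Mm}Km : 2 * K ^+ 2 + 2 * K + 1 <= m%:R.
  by apply: le_trans KM _; rewrite ler_nat; lia.
have := discrepancy_le m.+1 F1 FC.
rewrite sumrB sumr_const card_ord -(mulr_natr mu) -natr1.
set S := \sum_(_ < _) _.
have : ((addr m.+1).1%:R : R) ^+ 2 <= 2 * m%:R + 2.
  by have := addrE m.+1; rewrite -natrX -natrM -natrD ler_nat; nia.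
have : 0 <= (addr m.+1).1%:R :> R by [].
move: (addr m.+1).1%:R => N N0 Nm SN.
have KN : K * (N + 1) <= m%:R by nra.
rewrite ler_distlC ler_pdivlMr// ler_pdivrMr//.
have {KN} : (C + 2) * (N + 1) <= e * m%:R.
  by rewrite -ler_pdivrMl//; move: KN; rewrite /K; lra.
by move: SN; rewrite ler_norml; nra.
Qed.

Lemma cvg_freq_cst b : freq (fun=> b) @ \oo --> (b%:R : R).
Proof.
apply: (@cvg_freq (fun _ _ => b) _ 0); first by case: b => /=; lra.
by move=> n; rewrite sumr_const card_ord mulr_natr subrr normr0.
Qed.

Lemma cvg_freq_close (P Q : nat -> bool) (B l : R) :
  (forall m, `|\sum_(k < m.+1) (P k)%:R - \sum_(k < m.+1) (Q k)%:R| <= B) ->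
  freq P @ \oo --> l -> freq Q @ \oo --> l.
Proof.
move=> PQ Pl.
have B0 : 0 <= B := le_trans (normr_ge0 _) (PQ 0%N).
suff : (freq P m - freq Q m) @[m --> \oo] --> (0 : R).
  move=> PQ0; rewrite -[l]subr0.
  rewrite (_ : freq Q = fun m => freq P m - (freq P m - freq Q m)).
    exact: cvgB Pl PQ0.
  by apply/funext => m; rewrite subKr.
apply/cvgr0Pnorm_le => /= e e0.
exists (Num.bound (B / e)).+1 => // m /= Mm.
have m0 : 0 < m%:R :> R by rewrite ltr0n; lia.
rewrite /freq -mulrBl normrM normfV (gtr0_norm m0) ler_pdivrMr//.
apply: le_trans (PQ m) _; rewrite mulrC -ler_pdivrMr//.
apply: le_trans (ltW (archi_boundP _)) _; first by rewrite divr_ge0// ltW.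
by rewrite ler_nat ltnW.
Qed.

(** For a shift by one time the difference of the counts telescopes to one first and one last
    term. *)
Lemma cvg_freq_shift (P : nat -> bool) (l : R) i :
  freq P @ \oo --> l <-> freq (fun k => P (k + i)%N) @ \oo --> l.
Proof.
elim: i => [|i IHi].
  by rewrite (_ : (fun k => _) = P)//; apply/funext => k; rewrite addn0.
have B m : `|\sum_(k < m.+1) (P (k + i)%N)%:R
             - \sum_(k < m.+1) (P (k + i.+1)%N)%:R| <= 1 :> R.
  rewrite big_ord_recl [in X in _ - X]big_ord_recr /= add0n.
  under [X in _ - (X + _)]eq_bigr do rewrite addnS -addSn.
  rewrite addrKA ler_norml.
  by case: (P _); case: (P _) => /=; lra.
split=> [/IHi|]; first exact: cvg_freq_close B.
move=> Pl; apply/IHi; apply: cvg_freq_close Pl => m; rewrite distrC; exact: B.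
Qed.

Lemma cvg_freq_near (P Q : nat -> bool) (l : R) :
  (\forall k \near \oo, P k = Q k) ->
  freq P @ \oo --> l -> freq Q @ \oo --> l.
Proof.
move=> [K _ PQ] /(cvg_freq_shift _ _ K) Pl; apply/(cvg_freq_shift _ _ K).
rewrite (_ : (fun k => Q _) = (fun k => P (k + K)%N))//.
by apply/funext => k; rewrite PQ//= leq_addl.
Qed.

End Blocks.

(** * The two moving points *)

Section Position.
Context {R : realType}.
Implicit Types (c : bool) (n j k : nat).

(* The two moving points differ in the blocks n such that [phase n], where the
   second one moves twice as fast. Both are at 1 at the ends of every block,
   which keeps the second orbit slow when the phase changes. *)
Definition phase n : bool := odd (trunc_log 4 n).

(** From 1 down to 0 and back to 1: the tent map applied to the uniform array. A second application,
    in [pos], gives two such sweeps per block. *)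
Definition sweep n j : R := `|2 * (j%:R / n.+1%:R) - 1|.

Definition pos c n j : R :=
  if c && phase n then `|2 * sweep n j - 1| else sweep n j.

Lemma equidistributed_pos c : equidistributed (pos c).
Proof.
have [C uC] := equidistributed_tent (@equidistributed_uniform R).
have [C' vC] := equidistributed_tent
  (equidistributed_tent (@equidistributed_uniform R)).
exists (Num.max C C') => b x n; rewrite le_max /count_below /pos.
by case: (c && phase n); [rewrite vC orbT | rewrite uC].
Qed.

Lemma sweep_itv n j : (j <= n.+1)%N -> 0 <= sweep n j <= 1.
Proof.
move=> jn; rewrite normr_ge0 ler_norml /=.
have : 0 <= (j%:R / n.+1%:R : R) by rewrite divr_ge0.
have : (j%:R / n.+1%:R : R) <= 1 by rewrite ler_pdivrMr// mul1r ler_nat.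
by move: (j%:R / n.+1%:R) => s; lra.
Qed.

Lemma pos_itv c n j : (j <= n.+1)%N -> 0 <= pos c n j <= 1.
Proof.
move=> /sweep_itv sw; rewrite /pos; case: ifP => // _.
by rewrite normr_ge0 ler_norml; lra.
Qed.

Lemma sweep_step n j : `|sweep n j.+1 - sweep n j| <= 2 / n.+1%:R.
Proof.
apply: le_trans (ler_dist_dist _ _) _.
rewrite -[j.+1%:R]natr1 (mulrDl j%:R) mul1r.
have : 0 < (n.+1%:R : R)^-1 by rewrite invr_gt0.
by move: (n.+1%:R^-1) (j%:R / n.+1%:R) => r s r0; rewrite ler_norml; lra.
Qed.

Lemma pos_step c n j : `|pos c n j.+1 - pos c n j| <= 4 / n.+1%:R.
Proof.
have := sweep_step n j; have : 0 < (n.+1%:R : R)^-1 by rewrite invr_gt0.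
rewrite /pos; move: (n.+1%:R^-1) (sweep n j.+1) (sweep n j) => r s t r0.
case: ifP => _; rewrite ler_norml => st; last by rewrite ler_norml; lra.
by apply: le_trans (ler_dist_dist _ _) _; rewrite ler_norml; lra.
Qed.

(** Both sides are 1, which the tent map fixes. The end of a block is thus an ordinary step, to
    which [pos_step] applies. *)
Lemma pos_wrap c n : pos c n n.+1 = pos c n.+1 0.
Proof.
have e1 : sweep n n.+1 = 1.
  by rewrite /sweep divff ?pnatr_eq0// mulr1 (_ : 2 - 1 = 1) ?normr1//; lra.
have e0 : sweep n.+1 0 = 1 by rewrite /sweep mul0r mulr0 sub0r normrN normr1.
rewrite /pos e1 e0 (_ : 2 * 1 - 1 = 1 :> R) ?normr1; last lra.
by case: ifP; case: ifP.
Qed.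

Definition track c k : R := pos c (addr k).1 (addr k).2.

Lemma track_itv c k : 0 <= track c k <= 1.
Proof. by apply: pos_itv; rewrite ltnW// ltnS addr_bound. Qed.

Lemma track_step c k : `|track c k.+1 - track c k| <= 4 / (addr k).1.+1%:R.
Proof.
rewrite /track [addr k.+1]/addr iterS -/(addr k) /next_addr.
have := addr_bound k; case: (addr k) => n j /= jn.
case: ltnP => nj /=; first exact: pos_step.
have -> : j = n by apply/eqP; rewrite eqn_leq jn.
by rewrite -pos_wrap; exact: pos_step.
Qed.

Lemma track_step_small c (e : R) : 0 < e ->
  exists K, forall k, (K <= k)%N -> `|track c k.+1 - track c k| < e.
Proof.
move=> e0; exists ((Num.bound (4 / e)) ^ 2)%N => k /leq_addr1 Kk.
apply: le_lt_trans (track_step c k) _.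
rewrite ltr_pdivrMr// mulrC -ltr_pdivrMr//.
apply: lt_le_trans (archi_boundP _) _; first by rewrite divr_ge0// ltW.
by rewrite ler_nat ltnW.
Qed.

Lemma track_shift_cvg c i j :
  (track c (k + i) - track c (k + j)) @[k --> \oo] --> (0 : R).
Proof.
have step0 : (track c k.+1 - track c k) @[k --> \oo] --> (0 : R).
  apply/cvgr0Pnorm_lt => e /(track_step_small c)[K Kk].
  by exists K.
have shift0 l : (track c (k + l) - track c k) @[k --> \oo] --> (0 : R).
  elim: l => [|l IHl].
    by under eq_fun do rewrite addn0 subrr; exact: cvg_cst.
  rewrite (_ : (fun k => _) = (fun k =>
      (track c (k + l).+1 - track c (k + l)) + (track c (k + l) - track c k))).
    rewrite -[0](addr0 (0:R)); apply: cvgD IHl.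
    by rewrite (cvg_shiftn l (fun k => track c k.+1 - track c k)).
  by apply/funext => k; rewrite addnS addrA subrK.
rewrite (_ : (fun k => _) = (fun k =>
    (track c (k + i) - track c k) - (track c (k + j) - track c k))).
  by rewrite -[0](subr0 (0:R)); apply: cvgB.
by apply/funext => k; rewrite opprB addrA subrK.
Qed.

Lemma freq_track_near c (a d : R) : 0 < d ->
  exists l : R, freq (fun k => `|track c k - a| < d) @ \oo --> l.
Proof.
move=> d0; have [C CP] := count_itv_near (equidistributed_pos c).
have ad : clip (a - d) <= clip (a + d) by apply: le_clip; lra.
exists (clip (a + d) - clip (a - d)).
apply: (cvg_freq (P := fun n j => `|pos c n j - a| < d) (C := C)).
  by have := clip_itv (a - d); have := clip_itv (a + d); lra.
move=> n; under eq_bigr do rewrite ltr_distl.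
by apply: (CP false); rewrite /=; lra.
Qed.

End Position.

(** * The family of conjugate systems *)

Lemma metric_continuousP (R : realType) (X Y : metricType R) (f : X -> Y) :
  (forall x (e : R), 0 < e -> exists2 r : R, 0 < r &
     forall y, mdist x y < r -> mdist (f x) (f y) < e) -> continuous f.
Proof.
move=> fP x; apply/metricType_numDomainType.cvgrPdist_lt => e /(fP x)[r r0 xr].
by apply/metricType_numDomainType.nbhs_mdistP; exists r.
Qed.

Lemma exp2V_small (R : realType) (e : R) : 0 < e ->
  exists K, forall k, (K <= k)%N -> 2 ^- k < e.
Proof.
move=> e0; exists (Num.bound e^-1) => k Kk.
rewrite -[ltRHS]invrK ltf_pV2 ?posrE ?exprn_gt0 ?invr_gt0//.
apply: lt_trans (archi_boundP _) _; first by rewrite invr_ge0 ltW.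
by rewrite -natrX ltr_nat (leq_ltn_trans Kk)// ltn_expl.
Qed.

(* The points [(c, inl k)] form the orbit of the component [c], and the points
   [(c, inr t)] its segment of fixed points. The index [m] only occurs in the
   metric: it puts the components at distance 1 / (m + 1). *)
Definition tracks (R : realType) (m : nat) : Type :=
  (bool * (nat + {t : R | 0 <= t <= 1}))%type.

HB.instance Definition _ R m := Choice.on (tracks R m).

Section Tracks.
Context {R : realType} {m : nat}.
Implicit Types p q r : tracks R m.

(** Distinct positive heights make the orbit points isolated, and their decay to 0 makes them
    accumulate only on the segment of fixed points. *)
Definition height p : R := if p.2 is inl k then 2 ^- k else 0.

Definition coord p : R :=
  match p.2 with inl k => track p.1 k | inr t => val t end.

Definition gap p q : R := if p.1 == q.1 then 0 else m.+1%:R^-1.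

Definition tdist p q : R :=
  Num.max (gap p q) (Num.max `|height p - height q| `|coord p - coord q|).

Lemma height_inj k l : 2 ^- k = 2 ^- l :> R -> k = l.
Proof.
by move/invr_inj/(ieexprIn _ _); apply; rewrite ?ltr0n// pnatr_eq1.
Qed.

Let tdistxx p : tdist p p = 0.
Proof. by rewrite /tdist /gap eqxx !subrr normr0 !maxxx. Qed.

Let tdist_sym p q : tdist p q = tdist q p.
Proof.
by rewrite /tdist /gap (eq_sym p.1) (distrC (height p)) (distrC (coord p)).
Qed.

Let tdist_positivity p q : tdist p q = 0 -> p = q.
Proof.
move=> pq0; have : tdist p q <= 0 by rewrite pq0.
rewrite /tdist !ge_max !normr_le0 !subr_eq0 => /and3P[gpq].
case: p q gpq {pq0} => [c x] [c' y]; rewrite /gap /=.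
case: eqP => [<- _|_]; last by rewrite invr_le0 leNgt ltr0n.
rewrite /height /coord /=; case: x y => [k|t] [l|s] /=.
- by move=> /eqP/height_inj->.
- by rewrite invr_eq0 expf_eq0 pnatr_eq0 andbF.
- by rewrite eq_sym invr_eq0 expf_eq0 pnatr_eq0 andbF.
- by move=> _ /eqP/val_inj->.
Qed.

Let tdist_triangle q p r : tdist p r <= tdist p q + tdist q r.
Proof.
rewrite {1}/tdist !ge_max; apply/and3P; split.
- apply: (@le_trans _ _ (gap p q + gap q r)).
    have m0 : 0 <= m.+1%:R^-1 :> R by rewrite invr_ge0.
    rewrite /gap; move: (m.+1%:R^-1) m0 => g g0.
    case: (eqVneq p.1 q.1) => [->|_]; first by rewrite add0r.
    by case: ifP => _; case: ifP => _; lra.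
  by apply: lerD; rewrite le_max lexx.
- apply: le_trans (ler_distD (height q) _ _) _.
  by apply: lerD; rewrite !le_max lexx orbT.
- apply: le_trans (ler_distD (coord q) _ _) _.
  by apply: lerD; rewrite !le_max lexx !orbT.
Qed.

HB.instance Definition _ := isMetric.Build R (tracks R m)
  tdistxx tdist_positivity tdist_sym tdist_triangle.

Lemma mdistE p q : mdist p q = tdist p q. Proof. by []. Qed.

Definition step p : tracks R m :=
  (p.1, match p.2 with inl k => inl k.+1 | inr t => inr t end).

Lemma iter_step_inl k c l : iter k step (c, inl l) = (c, inl (k + l)%N).
Proof. by elim: k => //= k ->. Qed.

Lemma iter_step_inr k c t : iter k step (c, inr t) = (c, inr t).
Proof. by elim: k => //= k ->. Qed.

Lemma coord_itv p : 0 <= coord p <= 1.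
Proof. by case: p => c [k|[t]]//; exact: track_itv. Qed.

Lemma height_ge0 p : 0 <= height p.
Proof. by case: p => c [k|t] //=; rewrite /height invr_ge0 exprn_ge0. Qed.

Lemma height_le1 p : height p <= 1.
Proof.
case: p => c [k|t] //=; rewrite /height/= invf_le1 ?exprn_gt0//.
by rewrite exprn_ege1// ler1n.
Qed.

Lemma mdist_lt p q (e : R) : (mdist p q < e) =
  [&& gap p q < e, `|height p - height q| < e & `|coord p - coord q| < e].
Proof. by rewrite mdistE /tdist !gt_max. Qed.

Lemma mdist_le1 p q : mdist p q <= 1.
Proof.
rewrite mdistE /tdist !ge_max !ler_norml; apply/and3P; split.
- by rewrite /gap; case: ifP => // _; rewrite invf_le1 ?ltr0n// ler1n.
- have := height_le1 p; have := height_le1 q.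
  by have := height_ge0 p; have := height_ge0 q; lra.
- by have := coord_itv p; have := coord_itv q; lra.
Qed.

Lemma gap_small p q : gap p q < m.+1%:R^-1 -> p.1 = q.1.
Proof. by rewrite /gap; case: eqP => //; rewrite ltxx. Qed.

Lemma height_isolated k l : k != l -> 2 ^- k.+1 <= `|2 ^- k - 2 ^- l| :> R.
Proof.
have mono i j : (i <= j)%N -> 2 ^- j <= 2 ^- i :> R.
  by move=> ij; rewrite lef_pV2 ?posrE ?exprn_gt0// ler_eXn2l ?ltr1n.
have half i : 2 ^- i = 2 * 2 ^- i.+1 :> R.
  by rewrite exprS invfM mulrA divff ?mul1r// pnatr_eq0.
have pos : 0 < 2 ^- k.+1 :> R by rewrite invr_gt0 exprn_gt0.
have := half k; have := half l.
rewrite neq_ltn => hl hk /orP[/mono kl|/mono lk]; rewrite ler_normr;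
  apply/orP; [left|right]; lra.
Qed.

(** Orbit points are isolated. An orbit point close to a fixed point has small height, hence large
    index, and so moves by little. *)
Lemma step_continuous : continuous step.
Proof.
apply: metric_continuousP => -[c [k|t]] e e0.
  exists (Num.min m.+1%:R^-1 (2 ^- k.+1)).
    by rewrite lt_min !invr_gt0 exprn_gt0 ltr0n.
  move=> q; rewrite mdist_lt !lt_min => /and3P[/andP[/gap_small/= cq _]].
  move=> /andP[_ hq] _; suff <- : (c, inl k) = q by rewrite mdistxx.
  move: q cq hq => [_ [l|t]] /= <-; rewrite /height /=.
    have [->//|/height_isolated] := eqVneq k l.
    by move=> h1 h2; have := le_lt_trans h1 h2; rewrite ltxx.
  rewrite subr0 normfV normrX gtr0_norm ?ltr0n// ltf_pV2 ?posrE ?exprn_gt0//.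
  by rewrite ltr_eXn2l ?ltr1n// ltnNge leqW.
have e2 : 0 < e / 2 by rewrite divr_gt0.
have [K tK] := track_step_small c e2.
exists (Num.min m.+1%:R^-1 (Num.min (e / 2) (2 ^- K))).
  by rewrite !lt_min !invr_gt0 exprn_gt0 ltr0n//= e2.
move=> [c' x]; rewrite mdist_lt !lt_min => /and3P[/and3P[/gap_small/= <- _ _]].
case: x => [k|s] /and3P[_ he hK] /and3P[_ ce _]; last first.
  rewrite mdist_lt; apply/and3P; split; first by rewrite /gap eqxx.
    by apply: lt_trans he _; lra.
  by apply: lt_trans ce _; lra.
move: he hK; rewrite /height /= sub0r normrN normfV normrX gtr0_norm ?ltr0n//.
rewrite ltf_pV2 ?posrE ?exprn_gt0// ltr_eXn2l ?ltr1n// => he /ltnW Kk.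
rewrite mdist_lt; apply/and3P; split; first by rewrite /gap eqxx.
  rewrite /height /= sub0r normrN normfV normrX gtr0_norm ?ltr0n//.
  apply: le_lt_trans (_ : e / 2 < e); last lra.
  apply: le_trans (ltW he).
  by rewrite lef_pV2 ?posrE ?exprn_gt0// ler_eXn2l ?ltr1n.
have := tK _ Kk; move: ce; rewrite /coord /= !ltr_norml; lra.
Qed.

(** An ultrafilter is either principal or avoids every single point; in the latter case its heights
    tend to 0, and it converges to a fixed point whose coordinate is a cluster point of the
    coordinates. *)
Lemma tracks_compact : compact [set: tracks R m].
Proof.
rewrite compact_ultra => F FU _.
have F01 : F (coord @^-1` `[0, 1]%classic).
  by apply: filterS filterT => p _ /=; rewrite in_itv /=; exact: coord_itv.
have [t [t01 tF]] := @segment_compact R 0 1 (coord @ F) _ F01.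
have {}t01 : 0 <= t <= 1 by move: t01; rewrite /= in_itv.
have [[p Fp]|noF] := pselect (exists p, F [set p]).
  exists p; split => //; apply/metricType_numDomainType.fcvgrPdist_lt => e e0.
  by apply: filterS Fp => q ->; rewrite mdistxx.
have Fne p : F (~` [set p]).
  by have [Fp|//] := in_ultra_setVsetC [set p] FU; case: noF; exists p.
(* Each induction step removes the two orbit points of the next index, one per component. *)
have Fh k : F [set p | height p < 2 ^- k].
  elim: k => [|k IHk].
    apply: filterS (filterI (Fne (true, inl 0%N)) (Fne (false, inl 0%N))).
    move=> [c [k|s]] /= [nt nf]; rewrite /height /= expr0 invr1 ?ltr01//.
    case: k nt nf => [|k _ _]; first by case: c.
    by rewrite invf_lt1 ?exprn_gt0// exprn_egt1// ltr1n.
  apply: filterS (filterI IHk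
    (filterI (Fne (true, inl k.+1)) (Fne (false, inl k.+1)))).
  move=> [c [l|s]] /= [+ [nt nf]]; rewrite /height /= ?invr_gt0 ?exprn_gt0//.
  rewrite !ltf_pV2 ?posrE ?exprn_gt0// !ltr_eXn2l ?ltr1n// => kl.
  rewrite ltn_neqAle kl andbT; apply/eqP => lk.
  by case: c nt nf; rewrite -lk.
have [c Fc] : exists c, F [set p : tracks R m | p.1 = c].
  have [Ft|Ff] := in_ultra_setVsetC [set p : tracks R m | p.1 = true] FU.
    by exists true.
  by exists false; apply: filterS Ff => -[[] x] // /(_ erefl).
exists (c, inr (exist _ t t01)); split => //.
apply/metricType_numDomainType.fcvgrPdist_lt => e e0.
have [k /(_ k (leqnn k)) ke] := exp2V_small e0.
have Ft : F [set p | `|t - coord p| < e].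
  have [//|Fn] := in_ultra_setVsetC [set p | `|t - coord p| < e] FU.
  by have [y []] := tF (~` ball t e) (ball t e) Fn (nbhsx_ballx t e e0).
apply: filterS (filterI Fc (filterI (Fh k) Ft)) => p /= [pc [hp cp]].
rewrite mdist_lt; apply/and3P; split=> //; first by rewrite /gap /= pc eqxx.
by rewrite sub0r normrN ger0_norm ?height_ge0// (lt_trans hp).
Qed.

Lemma tracks_tds : is_tds step.
Proof.
split; [by exists (true, inl 0%N) | exact: tracks_compact |].
exact: step_continuous.
Qed.

End Tracks.

(** The identity works: the two metrics agree within each component, and a ball of radius at most
    the gap stays in one component. *)
Lemma tracks_conjugate (R : realType) (m m' : nat) :
  conjugate (@step R m) (@step R m').
Proof.
exists id; split => //; last by exists id.
apply: metric_continuousP => p e e0.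
exists (Num.min m.+1%:R^-1 e); first by rewrite lt_min e0 invr_gt0 ltr0n.
move=> q; rewrite mdist_lt !lt_min => /and3P[/andP[/gap_small pq _]].
move=> /andP[_ hpq] /andP[_ cpq]; rewrite mdist_lt.
by apply/and3P; split => //; rewrite /gap pq eqxx.
Qed.

(** * Closeness frequencies *)

Lemma closeness_freqE (R : realType) (X : metricType R) (f : X -> X) x y
    (d : R) :
  closeness_freq f x y d =
  freq (fun k => mdist (iter k f x) (iter k f y) < d).
Proof.
apply/funext => m; rewrite /closeness_freq /freq; congr (_ / _).
rewrite -sum1_card natr_sum big_mkcond /=; apply: eq_bigr => i _.
by rewrite inE; case: (_ < _).
Qed.

Lemma closeness_freq_sym (R : realType) (X : metricType R) (f : X -> X) x y
    (d : R) :
  closeness_freq f x y d = closeness_freq f y x d.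
Proof.
rewrite !closeness_freqE; congr freq.
by apply/funext => k; rewrite metric_sym.
Qed.

(** * Pairs within one component *)

Section SameComponent.
Context {R : realType} {m : nat}.

Lemma cvg_freq_same (p q : tracks R m) (d : R) : p.1 = q.1 -> 0 < d ->
  exists l : R, closeness_freq step p q d @ \oo --> l.
Proof.
move: p q => [c x] [_ y] /= <- d0.
have [K eK] := exp2V_small d0.
(* From time [K] on the height of the orbit point is below [d], so only the coordinates decide. *)
have mixed i s : exists l : R,
    closeness_freq step ((c, inl i) : tracks R m) (c, inr s) d @ \oo --> l.
  have [l tl] := freq_track_near c (val s) d0; exists l.
  rewrite closeness_freqE; move/(cvg_freq_shift _ _ i): tl.
  apply: cvg_freq_near; exists K => // k /= Kk.
  rewrite iter_step_inl iter_step_inr mdist_lt /gap eqxx d0 /height /coord /=.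
  have k0 : 0 <= 2 ^- (k + i) :> R by rewrite invr_ge0 exprn_ge0.
  by rewrite subr0 (ger0_norm k0) (eK _ (leq_trans Kk (leq_addr i k))).
case: x y => [i|t] [j|s]; last 1 first.
- pose b := mdist ((c, inr t) : tracks R m) (c, inr s) < d.
  exists (b%:R : R); rewrite closeness_freqE (_ : (fun k => _) = (fun=> b)).
    exact: cvg_freq_cst.
  by apply/funext => k; rewrite !iter_step_inr.
- exists (true%:R : R); rewrite closeness_freqE.
  apply: (@cvg_freq_near _ (fun=> true)); last exact: cvg_freq_cst.
  have /cvgr0Pnorm_lt/(_ d d0)[L _ tL] := track_shift_cvg (R := R) c i j.
  exists (maxn K L) => // k /=; rewrite geq_max => /andP[Kk /tL /= tk].
  rewrite !iter_step_inl mdist_lt /gap eqxx d0 /height /coord /= tk andbT.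
  have := eK (k + i)%N (leq_trans Kk (leq_addr i k)).
  have := eK (k + j)%N (leq_trans Kk (leq_addr j k)).
  have : 0 < 2 ^- (k + i) :> R by rewrite invr_gt0 exprn_gt0.
  have : 0 < 2 ^- (k + j) :> R by rewrite invr_gt0 exprn_gt0.
  by move=> ? ? ? ?; apply/esym; rewrite ltr_norml; lra.
- exact: mixed.
- have [l ml] := mixed j t; exists l.
  by rewrite closeness_freq_sym.
Qed.

End SameComponent.

(** A single delta with convergent frequencies refutes the pair; the midpoint is positive. For
    [m = 0] the gap is 1, the largest possible distance, so cross distances are constantly 1. *)
Lemma no_DC3_pair (R : realType) : ~ has_DC3_pair (@step R 0).
Proof.
move=> [p [q [a [b [a0 ab _ DC]]]]].
have /DC : a < (a + b) / 2 < b by lra.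
have d0 : 0 < (a + b) / 2 by lra.
suff [l /cvg_limn_inf_sup[]] : exists l : R,
    closeness_freq step p q ((a + b) / 2) @ \oo --> l.
  by rewrite /Phi_lower /Phi_upper => -> ->; rewrite ltxx.
have [pq|pq] := eqVneq p.1 q.1; first exact: cvg_freq_same.
move: ((a + b) / 2) d0 => d d0.
pose far := 1 < d; exists (far%:R : R); rewrite closeness_freqE.
rewrite (_ : (fun k => _) = (fun=> far)); first exact: cvg_freq_cst.
apply/funext => k; congr (_ < d).
have : (iter k step p).1 != (iter k step q).1.
  by elim: k => [|k IHk].
move: (iter k step p) (iter k step q) => {pq DC} {}p {}q pq.
apply/eqP; rewrite eq_le mdist_le1 mdistE /tdist /gap (negbTE pq) invr1.
by rewrite le_max lexx.
Qed.

(** * Lower and upper limits from values at arbitrarily large times *)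

Section LimitInferiorSuperior.
Context {R : realType}.
Implicit Type u : nat -> R.

Lemma limn_sup_ge u l : bounded_fun u ->
  (forall n, exists2 m, (n <= m)%N & l <= u m) -> l <= limn_sup u.
Proof.
move=> bu ul; rewrite limn_supE//; apply: lb_le_inf.
  by exists (sups u 0%N), 0%N.
move=> _ [n _ <-]; have [m nm lm] := ul n.
apply: le_trans lm _; apply: ub_le_sup; last by exists m.
by apply: has_ubound_sdrop; exact: bounded_fun_has_ubound.
Qed.

Lemma limn_inf_le u l : bounded_fun u ->
  (forall n, exists2 m, (n <= m)%N & u m <= l) -> limn_inf u <= l.
Proof.
move=> bu ul; rewrite limn_infE//; apply: ge_sup.
  by exists (infs u 0%N), 0%N.
move=> _ [n _ <-]; have [m nm lm] := ul n.
apply: le_trans lm; apply: ge_inf; last by exists m.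
by apply: has_lbound_sdrop; exact: bounded_fun_has_lbound.
Qed.

Lemma bounded_freq (P : nat -> bool) : bounded_fun (freq P : nat -> R).
Proof.
(* (m + 1) / m <= 2 for m >= 1, and the quotient is 0 at m = 0. *)
exists 2; split; first exact: num_real.
move=> M M2 m _; apply: le_trans (ltW M2).
have S0 : 0 <= \sum_(k < m.+1) (P k)%:R :> R by apply: sumr_ge0.
have S1 : \sum_(k < m.+1) (P k)%:R <= m.+1%:R :> R.
  rewrite -[m.+1 in leRHS]card_ord -sumr_const; apply: ler_sum => k _.
  by rewrite lern1 leq_b1.
rewrite /freq; case: m S0 S1 => [|m] S0 S1; first by rewrite invr0 mulr0 normr0.
rewrite ger0_norm ?divr_ge0// ler_pdivrMr ?ltr0n//.
by apply: le_trans S1 _; rewrite -natrM ler_nat; lia.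
Qed.

End LimitInferiorSuperior.

(** * Oscillating frequencies of the two moving points *)

Section ScrambledPair.
Context {R : realType}.
Implicit Types (c : nat -> R) (d : R).

(** The trivial bound on the first [M] blocks costs little: they fill only about 1/16 of the time
    spent in the first [4 * M]. *)
Lemma sum_last_blocks c (a C : R) M : a <= 1 -> 0 <= C ->
  (forall n, c n <= n.+1%:R) ->
  (forall n, (M <= n < 4 * M)%N -> c n <= a * n.+1%:R + C) ->
  \sum_(n < 4 * M) c n <= a * ((4 * M * (4 * M).+1)%:R / 2)
    + (1 - a) * ((M * M.+1)%:R / 2) + C * (4 * M)%:R.
Proof.
move=> a1 C0 c1 cM; rewrite -!sum_nat_succ.
rewrite (_ : (4 * M = M + 3 * M)%N); last lia.
rewrite !(@big_split_ord _ _ _ M (3 * M)) /= (natrD _ M).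
have h1 : \sum_(n < M) c n <= \sum_(n < M) n.+1%:R by apply: ler_sum.
have h2 : \sum_(n < 3 * M) c (M + n)%N <=
    \sum_(n < 3 * M) (a * (M + n).+1%:R + C).
  by apply: ler_sum => n _; apply: cM; have := ltn_ord n; lia.
rewrite big_split /= sumr_const card_ord -mulr_natr -mulr_sumr in h2.
have : 0 <= C * M%:R by rewrite mulr_ge0.
lra.
Qed.

Definition near_count d n : R :=
  \sum_(j < n.+1) (`|sweep n j - pos true n j| < d)%R%:R.

Lemma near_count_le d n : near_count d n <= n.+1%:R.
Proof.
rewrite -[n.+1 in leRHS]card_ord -sumr_const; apply: ler_sum => j _.
by rewrite lern1 leq_b1.
Qed.

Lemma near_count_together d n : 0 < d -> ~~ phase n -> near_count d n = n.+1%:R.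
Proof.
move=> d0 nn; rewrite /near_count /pos (negbTE nn).
rewrite (eq_bigr (fun=> 1)) ?sumr_const ?card_ord// => j _.
by rewrite subrr normr0 d0.
Qed.

(** By equidistribution about 1/6 of the positions of the first point lie below 1/6, where the
    second point is more than 1/2 away. *)
Lemma near_count_apart : exists2 C : R, 0 <= C &
  forall d n, d < 1 / 2 -> phase n -> near_count d n <= 5 / 6 * n.+1%:R + C.
Proof.
have [C CP] := equidistributed_pos (R := R) false.
exists C => [|d n d2 nn]; first exact: le_trans (normr_ge0 _) (CP true 0 0%N).
have := CP false (1 / 6) n; rewrite clip_id; last lra.
rewrite ler_norml => /andP[+ _].
suff : near_count d n + count_below (pos false) false (1 / 6) n <= n.+1%:R.
  by lra.
rewrite /near_count /count_below -big_split /= -[n.+1 in leRHS]card_ord.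
rewrite -sumr_const.
apply: ler_sum => j _; rewrite /pos nn /=.
have /sweep_itv : (j <= n.+1)%N by rewrite ltnW.
(* if s < 1 / 6, then |2 s - 1| - s = 1 - 3 s > 1 / 2 > d *)
move: (sweep n j) => s s01.
case: (ltP s (1 / 6)) => s6; last by rewrite addr0 lern1 leq_b1.
rewrite ltNge (_ : d <= _) ?add0r//.
rewrite ler_normr; apply/orP; right.
have : `|2 * s - 1| = 1 - 2 * s by rewrite ler0_norm; lra.
by move=> ->; lra.
Qed.

Definition near_freq d : nat -> R :=
  freq (fun k => `|track false k - track true k| < d).

(** Since [freq] at m counts m + 1 times, the predecessor of N(N+1)/2 is the index covering exactly
    the first [N] blocks. *)
Lemma near_freq_block d N : (0 < N)%N ->
  near_freq d (N * N.+1)./2.-1 =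
  (\sum_(n < N) near_count d n) / ((N * N.+1)./2.-1)%:R.
Proof.
move=> N0; have T0 : (0 < (N * N.+1)./2)%N by rewrite half_gt0; nia.
rewrite /near_freq /freq prednK// /track; congr (_ / _).
rewrite (sum_blocks (fun n j => (`|pos false n j - pos true n j| < d)%R%:R)).
rewrite (@addr_block N).
  by rewrite big_ord0 addr0.
by rewrite -[RHS]odd_double_half oddM /= andbN.
Qed.

Lemma natr_half_block N :
  (0 < N)%N -> ((N * N.+1)./2.-1)%:R = (N * N.+1)%:R / 2 - 1 :> R.
Proof.
move=> N0; have T0 : (0 < (N * N.+1)./2)%N by rewrite half_gt0; nia.
have E : (N * N.+1 = 2 * (N * N.+1)./2)%N.
  by rewrite mul2n -[LHS]odd_double_half oddM /= andbN.
rewrite {2}E natrM mulrC mulKf ?pnatr_eq0//.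
by rewrite -[in RHS](prednK T0) -natr1 addrK.
Qed.

Lemma phaseE i n : (4 ^ i <= n < 4 ^ i.+1)%N -> phase n = odd i.
Proof. by move=> h; rewrite /phase (trunc_log_eq _ h). Qed.

(** The points coincide in the blocks from 4^i to 4^(i+1), so misses occur only in the earlier ones:
    the share is about 15/16 or more, above 9/10. *)
Lemma near_freq_ge d i : 0 < d -> ~~ odd i ->
  9 / 10 <= near_freq d (4 ^ i.+1 * (4 ^ i.+1).+1)./2.-1.
Proof.
move=> d0 ei; set M := (4 ^ i)%N; have M0 : (0 < M)%N by rewrite expn_gt0.
have S : \sum_(n < 4 * M) (n.+1%:R - near_count d n) <=
    0 * ((4 * M * (4 * M).+1)%:R / 2)
    + (1 - 0) * ((M * M.+1)%:R / 2) + 0 * (4 * M)%:R.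
  apply: (sum_last_blocks (c := fun n => n.+1%:R - near_count d n)) => //.
    by move=> n; rewrite lerBlDr lerDl sumr_ge0.
  move=> n ni; rewrite near_count_together ?subrr ?mul0r ?addr0//.
  by rewrite (phaseE (i := i))// expnS.
move: S; rewrite sumrB sum_nat_succ expnS -/M near_freq_block ?muln_gt0//.
rewrite natr_half_block ?muln_gt0// ler_pdivlMr; last first.
  by rewrite subr_gt0 ltr_pdivlMr// mul1r ltr_nat; nia.
have : 1 <= M%:R :> R by rewrite ler1n.
rewrite !natrM -[(4 * M).+1%:R]natr1 -[M.+1%:R]natr1 natrM.
by move: (M%:R) => r r1; nra.
Qed.

(** The share is at most about 5/6 + 1/6 * 1/16 = 27/32, below 88/100; the lower bound on [M]
    absorbs the error terms. *)
Lemma near_freq_le : exists I : nat, forall d i,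
  d < 1 / 2 -> (I <= i)%N -> odd i ->
  near_freq d (4 ^ i.+1 * (4 ^ i.+1).+1)./2.-1 <= 88 / 100.
Proof.
have [C C0 CP] := near_count_apart.
exists (Num.bound (100 * C + 100)) => d i d2 Ii oi.
set M := (4 ^ i)%N; have M0 : (0 < M)%N by rewrite expn_gt0.
have S : \sum_(n < 4 * M) near_count d n <=
    5 / 6 * ((4 * M * (4 * M).+1)%:R / 2)
    + (1 - 5 / 6) * ((M * M.+1)%:R / 2) + C * (4 * M)%:R.
  apply: sum_last_blocks => //; [lra | exact: near_count_le |].
  by move=> n ni; apply: CP => //; rewrite (phaseE (i := i))// expnS.
move: S; rewrite expnS -/M near_freq_block ?muln_gt0//.
rewrite natr_half_block ?muln_gt0// ler_pdivrMr; last first.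
  by rewrite subr_gt0 ltr_pdivlMr// mul1r ltr_nat; nia.
have : 100 * C + 100 <= M%:R.
  apply: le_trans (ltW (archi_boundP _)) _; first by lra.
  by rewrite ler_nat (leq_trans Ii)// ltnW// ltn_expl.
rewrite !natrM -[(4 * M).+1%:R]natr1 -[M.+1%:R]natr1 natrM.
by move: (M%:R) => r r1; nra.
Qed.

End ScrambledPair.

(** For [m = 3] the gap is 1/4. Above 1/4 the gap is invisible, the heights agree at all times, and
    only the coordinates matter; below 1/2 their closeness frequency oscillates. *)
Lemma tracks_DC3_pair (R : realType) : has_DC3_pair (@step R 3).
Proof.
pose x : tracks R 3 := (false, inl 0%N); pose y : tracks R 3 := (true, inl 0%N).
exists x, y, (1 / 4), (1 / 2); split; [lra | lra | |].
  have p0 : 0 <= (0 : R) <= 1 by lra.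
  (* The two ends of a segment of fixed points show that the diameter is at least 1/2. *)
  have p1 : 0 <= (1 : R) <= 1 by lra.
  apply: (@le_trans _ _ (mdist ((false, inr (exist _ 0 p0)) : tracks R 3)
                               (false, inr (exist _ 1 p1)))).
    rewrite mdistE /tdist !le_max !ler_normr.
    have h : 1 / 2 <= - ((0 : R) - 1) by lra.
    by do 3![apply/orP; right]; exact: h.
  apply: ub_le_sup; last by eexists; eexists.
  by exists 1 => _ [p [q ->]]; exact: mdist_le1.
move=> d /andP[d4 d2]; have d0 : 0 < d by lra.
rewrite /Phi_lower /Phi_upper closeness_freqE.
rewrite (_ : freq _ = near_freq d); last first.
  congr freq; apply/funext => k.
  rewrite !iter_step_inl mdist_lt /gap /height /=.
  by rewrite subrr normr0 d0 !addn0 (_ : 4%:R^-1 < d)//; lra.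
have N_large n i : (n <= i)%N ->
    (n <= (4 ^ i.+1 * (4 ^ i.+1).+1)./2.-1)%N.
  move=> ni; have : (i.+1 < 4 ^ i.+1)%N by exact: ltn_expl.
  move: (4 ^ i.+1)%N => N iN.
  have : (i.+1 * 2 <= N * N.+1)%N by nia.
  by rewrite -[(N * _)%N]odd_double_half; lia.
have [I near_le] := @near_freq_le R.
apply: (@le_lt_trans _ _ (88 / 100)).
  apply: limn_inf_le; first exact: bounded_freq.
  (* An odd index beyond both [n] and [I]: the points have just been apart. *)
  move=> n; pose i := (n + I).*2.+1.
  exists ((4 ^ i.+1 * (4 ^ i.+1).+1)./2.-1)%N; first by apply: N_large; lia.
  by apply: near_le => //; rewrite /i ?oddS ?odd_double//; lia.
apply: (@lt_le_trans _ _ (9 / 10)); first lra.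
apply: limn_sup_ge; first exact: bounded_freq.
move=> n; exists ((4 ^ n.*2.+1 * (4 ^ n.*2.+1).+1)./2.-1)%N.
  by apply: N_large; lia.
by apply: near_freq_ge => //; rewrite odd_double.
Qed.

Theorem theorem2 (R : realType) :
  exists (X Y : metricType R) (f : X -> X) (g : Y -> Y),
    [/\ is_tds f, is_tds g, conjugate f g,
        has_DC3_pair f & ~ has_DC3_pair g].
Proof.
exists (tracks R 3), (tracks R 0), step, step; split.
- exact: tracks_tds.
- exact: tracks_tds.
- exact: tracks_conjugate.
- exact: tracks_DC3_pair.
- exact: no_DC3_pair.
Qed.
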